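(* Let $G$ be a group, $T$ a type of algebras, and $(\theta,\mathcal A)\in\mathsf{pA}(G,\mathsf{pAl}(T))$ such that the relative subalgebra $\mathcal D_x$ on $D_x$ is a subalgebra of $\mathcal A$ for all $x\in G$. Then there is a globalization of $(\theta,\mathcal A)$ in $\mathsf A(G,\mathsf{pAl}(T))$.
   Context: Partial actions. A partial action of a group $G$ on a set $A$ is a partial map $\theta:G\times A\dashrightarrow A$ such that for all $x,y\in G$, $a\in A$: (i) $\theta(1,a)$ is defined and equals $a$; (ii) if $\theta(x,a)$ is defined, then $\theta(x^{-1},\theta(x,a))$ is defined and equals $a$; (iii) if $\theta(y,a)$ and $\theta(x,\theta(y,a))$ are defined, then $\theta(xy,a)$ is defined and equals $\theta(x,\theta(y,a))$. It is global if everywhere defined. One writes $xa$ for $\theta(x,a)$ and $xa\neq\varnothing$ for ''$xa$ is defined''. The domain $D_x$ is the set $\{\theta(x,a)\mid a\in A,\ \theta(x,a)\text{ defined}\}$, and $\theta_x=\theta(x,-)$ is a bijection $D_{x^{-1}}\to D_x$. Partial algebras. A type of algebras is a sequence $T=\{n_\gamma\}_{\gamma<o(T)}$ of non-negative integers indexed by ordinals. A partial algebra $\mathcal A$ of type $T$ is a set $A$ with partial operations $(f_\gamma)_{\mathcal A}:A^{n_\gamma}\dashrightarrow A$ (if $n_\gamma=0$, $f_\gamma$ is an element of $A$ or undefined). A homomorphism $\varphi:\mathcal A\to\mathcal B$ is a map $A\to B$ such that whenever $f_\gamma(a_1,\dots,a_{n_\gamma})$ is defined, so is $f_\gamma(\varphi(a_1),\dots,\varphi(a_{n_\gamma}))$,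 and it equals $\varphi(f_\gamma(a_1,\dots,a_{n_\gamma}))$. The relative subalgebra on $B\subseteq A$ has $f_\gamma(b_1,\dots,b_{n_\gamma})$ defined iff it is defined in $\mathcal A$ and its value lies in $B$ (with the same value). It is a subalgebra if $B$ is closed: whenever $b_1,\dots,b_{n_\gamma}\in B$ and $(f_\gamma)_{\mathcal A}(b_1,\dots,b_{n_\gamma})$ is defined, its value lies in $B$ (for $n_\gamma=0$: if $f_\gamma$ is defined, then $f_\gamma\in B$). A partial action of $G$ on $\mathcal A$ is a partial action of $G$ on the set $A$ such that whenever $f_\gamma(a_1,\dots,a_{n_\gamma})$, $xa_1,\dots,xa_{n_\gamma}$ and $xf_\gamma(a_1,\dots,a_{n_\gamma})$ are defined, $f_\gamma(xa_1,\dots,xa_{n_\gamma})$ is defined and equals $xf_\gamma(a_1,\dots,a_{n_\gamma})$ (for $n_\gamma=0$: if $xf_\gamma$ is defined, then $xf_\gamma=f_\gamma$). $\mathsf{pA}(G,\mathsf{pAl}(T))$ is the category of pairs $(\theta,\mathcal A)$ with $\theta$ a partial action of $G$ on a partial algebra $\mathcal A$ of type $T$; morphisms $(\theta,\mathcal A)\to(\theta',\mathcal A')$ are homomorphisms $\varphi$ such that $xa\neq\varnothing$ implies that $x\varphi(a)$ is defined and equals $\varphi(xa)$. $\mathsf A(G,\mathsf{pAl}(T))$ is the full subcategory of pairs with global $\theta$. A globalization of $(\theta,\mathcal A)$ in $\mathsf A(G,\mathsf{pAl}(T))$ is $(\vartheta,\mathcal B)\in\mathsf A(G,\mathsf{pAl}(T))$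 with an injective morphism $\iota:(\theta,\mathcal A)\to(\vartheta,\mathcal B)$ such that (1) $xa\neq\varnothing\iff x\iota(a)\in\iota(A)$ for all $x\in G$, $a\in A$; (2) if $f_\gamma(\iota(a_1),\dots,\iota(a_{n_\gamma}))$ is defined in $\mathcal B$ and equals $\iota(b)$ for some $b\in A$, then $f_\gamma(a_1,\dots,a_{n_\gamma})$ is defined in $\mathcal A$ and equals $b$. *)

(* Defs.v *)
From mathcomp Require Import all_boot monoid.
From mathcomp Require Import classical_sets.

Set Implicit Arguments.
Unset Strict Implicit.
Unset Printing Implicit Defensive.

Local Open Scope classical_set_scope.
Local Open Scope group_scope.

(* A partial map X --> Y is a function X -> option Y: [f x = Some y] reads
   "f x is defined and equals y", [isSome (f x)] reads "f x is defined". *)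

Record partial_action (G : groupType) (A : Type) := PartialAction {
  pact :> G -> A -> option A;
  pact1 : forall a, pact 1 a = Some a;
  pactV : forall x a b, pact x a = Some b -> pact x^-1 b = Some a;
  pactM : forall x y a b c,
    pact y a = Some b -> pact x b = Some c -> pact (x * y) a = Some c
}.

Definition is_global (G : groupType) (A : Type) (theta : partial_action G A) :=
  forall x a, isSome (theta x a).

(* D_x is the image of theta_x, i.e. the domain of theta_(x^-1). *)
Definition pact_dom (G : groupType) (A : Type) (theta : partial_action G A)
    (x : G) : set A :=
  [set b | exists a, theta x a = Some b].

(* A type of algebras {n_gamma}_(gamma < o(T)): the ordinals below o(T) only
   serve as labels for the operations, so they are replaced by a type. *)
Record alg_type := AlgType {
  op_label :> Type;
  arity : op_label -> nat
}.

(* When [arity g = 0], [(arity g).-tuple A] has the single element [::], so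
   that [palg_op g] amounts to an element of [option A]. *)
Record palgebra (T : alg_type) := PAlgebra {
  palg_sort :> Type;
  palg_op : forall g : T, (arity g).-tuple palg_sort -> option palg_sort
}.

Definition is_hom (T : alg_type) (A B : palgebra T) (phi : A -> B) :=
  forall (g : T) (a : (arity g).-tuple A) (c : A),
    palg_op a = Some c -> palg_op (map_tuple phi a) = Some (phi c).

(* The relative subalgebra on B is a subalgebra iff B is closed under the
   operations. *)
Definition is_subalgebra (T : alg_type) (A : palgebra T) (B : set A) :=
  forall (g : T) (a : (arity g).-tuple A) (c : A),
    (forall i, B (tnth a i)) -> palg_op a = Some c -> B c.

(* [b] below is the tuple (x a_1, ..., x a_n), and [d] is x f(a_1, ..., a_n). *)
Definition acts_on_palgebra (G : groupType) (T : alg_type) (A : palgebra T)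
    (theta : partial_action G A) :=
  forall (x : G) (g : T) (a b : (arity g).-tuple A) (c d : A),
    palg_op a = Some c ->
    (forall i, theta x (tnth a i) = Some (tnth b i)) ->
    theta x c = Some d ->
    palg_op b = Some d.

(* The objects and the morphisms of pA(G, pAl(T)). *)
Record pA_obj (G : groupType) (T : alg_type) := PAObj {
  pA_alg :> palgebra T;
  pA_act : partial_action G pA_alg;
  pA_actP : acts_on_palgebra pA_act
}.

Record pA_hom (G : groupType) (T : alg_type) (X Y : pA_obj G T) := PAHom {
  pA_fun :> X -> Y;
  pA_fun_hom : is_hom pA_fun;
  pA_fun_act : forall (x : G) (a b : X),
    pA_act X x a = Some b -> pA_act Y x (pA_fun a) = Some (pA_fun b)
}.

(* The objects of the full subcategory A(G, pAl(T)). *)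
Record A_obj (G : groupType) (T : alg_type) := AObj {
  A_pA :> pA_obj G T;
  A_global : is_global (pA_act A_pA)
}.

Record is_globalization (G : groupType) (T : alg_type)
    (X : pA_obj G T) (Y : A_obj G T) (iota : pA_hom X Y) : Prop :=
  IsGlobalization {
  globalization_inj : injective iota;
  globalization_act : forall (x : G) (a : X),
    isSome (pA_act X x a) <->
    exists2 c : Y, pA_act Y x (iota a) = Some c & range iota c;
  globalization_op : forall (g : T) (a : (arity g).-tuple X) (b : X),
    palg_op (map_tuple iota a) = Some (iota b) -> palg_op a = Some b
}.

(* Main.v *)
Require Import Defs.
From mathcomp Require Import all_boot monoid.
From mathcomp Require Import boolp classical_sets.
From mathcomp Require Import generic_quotient.

(** The globalization is the usual enveloping action: the quotient of [G * A]
by the relation identifying [(x, a)] with [(y, b)] when [y^-1 x] is defined at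
[a] and sends it to [b] (so that [x a = y b] in any globalization), on which
[G] acts by left translation of the first component. Write [x # a] for the
class of [(x, a)] ([env_cls]); then [iota a = 1 # a].

The operations are the least ones making [iota] a homomorphism and the
translations automorphisms: [f (x # a_1, ..., x # a_n) = x # f (a_1, ..., a_n)]
whenever the right-hand side is defined. The closedness of the domains makes
this single-valued ([env_rel_functional]): if
[x # a_i = y # b_i] for all [i], then all the [a_i] lie in the domain of
[theta_z] with [z = y^-1 x], which is [D_(z^-1)]; as that set is closed under
the operations, [z f(a)] is defined whenever [f(a)] is, and compatibility of
the partial action with [f] gives [f(b) = z f(a)], that is
[x # f(a) = y # f(b)]. For a constant [f], closedness means that [f] lies in
every [D_z], and the same argument applies.

That [iota] reflects the action and the operations comes from
[x # a = 1 # b] meaning exactly [x a = b]: for the operations, if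
[f (iota a) = iota b] is witnessed by [x # a'_i = iota a_i] and
[x # f(a') = iota b], then [a_i = x a'_i] and [b = x f(a')], and compatibility
of the partial action with [f] yields [f(a) = b] ([env_iota_globalization]). *)

Set Implicit Arguments.
Unset Strict Implicit.
Unset Printing Implicit Defensive.

Local Open Scope group_scope.
Local Open Scope quotient_scope.

(** * Partial functions from functional relations *)

Definition pfun_of_rel (U V : Type) (R : U -> V -> Prop) (u : U) : option V :=
  if pselect (exists v, R u v) is left H then Some (projT1 (cid H)) else None.

Lemma pfun_of_relP (U V : Type) (R : U -> V -> Prop) :
  (forall u v w, R u v -> R u w -> v = w) ->
  forall u v, pfun_of_rel R u = Some v <-> R u v.
Proof.
move=> Rfun u v; rewrite /pfun_of_rel; case: pselect => [H|nR].
  case: cid => w /= Ruw; split=> [[<-] //|Ruv].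
  by congr Some; apply: Rfun Ruw Ruv.
by split=> // Ruv; exfalso; apply: nR; exists v.
Qed.

(** * The enveloping action of a partial action on a set *)

Section EnvelopingAction.
Variables (G : groupType) (A : Type) (theta : partial_action G A).

Lemma pact_inv x a b :
  theta x a = Some b <-> theta x^-1 b = Some a.
Proof. by split=> H; have := pactV H; rewrite ?invgK. Qed.

(** The alias [{classic _}] supplies the choice structure that quotients by a
boolean relation require. *)
Let pairs := {classic (G * A)%type}.

Definition env_eq : rel pairs :=
  fun p q => `[< theta (q.1^-1 * p.1) p.2 = Some q.2 >].

Lemma env_eq_refl : reflexive env_eq.
Proof. by move=> p; apply/asboolP; rewrite mulVg pact1. Qed.

Lemma env_eq_sym : symmetric env_eq.
Proof.
move=> p q; apply/asboolP/asboolP => /pact_inv;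
  by rewrite invgM invgK.
Qed.

Lemma env_eq_trans : transitive env_eq.
Proof.
move=> q p r /asboolP pq /asboolP qr; apply/asboolP.
by have := pactM pq qr; rewrite mulgA mulgK.
Qed.

Canonical env_equiv := EquivRel env_eq env_eq_refl env_eq_sym env_eq_trans.

Definition env := {eq_quot env_equiv}.

Definition env_cls (x : G) (a : A) : env := \pi_env ((x, a) : pairs).

Lemma env_clsP x a y b :
  env_cls x a = env_cls y b <-> theta (y^-1 * x) a = Some b.
Proof. by split=> [/eqmodP/asboolP|H] //; apply/eqmodP/asboolP. Qed.

Lemma env_cls_surj (u : env) : exists x a, u = env_cls x a.
Proof. by exists (repr u).1, (repr u).2; rewrite -[LHS]reprK; case: (repr u). Qed.

(** The translation is computed on a chosen representative; [env_actE] shows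
that the choice does not matter. *)
Definition env_act (x : G) (u : env) : env :=
  env_cls (x * (repr u).1) (repr u).2.

Lemma env_actE x y a : env_act x (env_cls y a) = env_cls (x * y) a.
Proof.
have: env_cls (repr (env_cls y a)).1 (repr (env_cls y a)).2 = env_cls y a.
  by rewrite -[RHS]reprK; case: (repr _).
move=> /env_clsP ya; apply/env_clsP.
by rewrite invgM -mulgA mulKg.
Qed.

Lemma env_act1 u : env_act 1 u = u.
Proof. by have [x [a ->]] := env_cls_surj u; rewrite env_actE mul1g. Qed.

Lemma env_actM x y u : env_act (x * y) u = env_act x (env_act y u).
Proof. by have [z [a ->]] := env_cls_surj u; rewrite !env_actE mulgA. Qed.

Definition env_pact : partial_action G env.
Proof.
exists (fun x u => Some (env_act x u)).
- by move=> u; rewrite env_act1.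
- by move=> x u v [<-]; rewrite -env_actM mulVg env_act1.
- by move=> x y u v w [<-] [<-]; rewrite env_actM.
Defined.

End EnvelopingAction.

(** * The enveloping algebra *)

Section EnvelopingAlgebra.
Variables (G : groupType) (T : alg_type) (X : pA_obj G T).

Local Notation theta := (pA_act X).
Local Notation cls := (env_cls theta).

(** All the arguments must share the same first component [x]; for a constant,
every [x] is a witness. *)
Definition env_rel (g : T) (u : (arity g).-tuple (env theta)) (v : env theta) :=
  exists x a c, [/\ u = map_tuple (cls x) a, palg_op a = Some c & v = cls x c].

Definition env_alg : palgebra T :=
  PAlgebra (fun g : T => pfun_of_rel (@env_rel g)).

Hypothesis dom_closed : forall x, is_subalgebra (pact_dom theta x).

(** Two witnesses [x # a_i = y # b_i] differ by [z = y^-1 x]; the closed set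
that contains all the [a_i] is the image of [z^-1], that is the domain of
[z]. *)
Lemma env_rel_functional g (u : (arity g).-tuple (env theta)) v w :
  env_rel u v -> env_rel u w -> v = w.
Proof.
move=> [x [a [c [-> fa ->]]]] [y [b [d [ab fb ->]]]]; apply/env_clsP.
have {}ab i : theta (y^-1 * x) (tnth a i) = Some (tnth b i).
  by apply/env_clsP; have /(congr1 (fun t => tnth t i)) := ab; rewrite !tnth_map.
have [e ec] : pact_dom theta (y^-1 * x)^-1 c.
  apply: dom_closed fa => i; exists (tnth b i); exact: pactV (ab i).
have {}ec : theta (y^-1 * x) c = Some e by apply/pact_inv.
by have := pA_actP fa ab ec; rewrite fb ec.
Qed.

Lemma env_opP (g : T) (u : (arity g).-tuple env_alg) (v : env_alg) :
  palg_op u = Some v <-> env_rel u v.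
Proof. exact: (pfun_of_relP (@env_rel_functional g)). Qed.

Lemma env_acts : acts_on_palgebra (A := env_alg) (env_pact theta).
Proof.
move=> x g u v c d /env_opP[y [a [e [-> fa ->]]]] uv [<-].
apply/env_opP; exists (x * y), a, e; split=> //; last exact: env_actE.
apply: eq_from_tnth => i; have [] := uv i.
by rewrite !tnth_map env_actE.
Qed.

Definition env_pA : pA_obj G T := PAObj env_acts.

Lemma env_global : is_global (pA_act env_pA).
Proof. by []. Qed.

Definition env_A : A_obj G T := AObj env_global.

Lemma env_iota_hom : is_hom (A := X) (B := env_alg) (cls 1).
Proof. by move=> g a c fa; apply/env_opP; exists 1, a, c. Qed.

Lemma env_cls_iota x a b : cls x a = cls 1 b <-> theta x a = Some b.
Proof. by rewrite env_clsP invg1 mul1g. Qed.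

Lemma env_iota_act x (a b : X) :
  theta x a = Some b -> env_pact theta x (cls 1 a) = Some (cls 1 b).
Proof. by move=> /env_cls_iota <-; rewrite /= env_actE mulg1. Qed.

Definition env_iota : pA_hom X env_A :=
  @PAHom G T X env_A (cls 1) env_iota_hom env_iota_act.

Lemma env_iota_globalization : is_globalization env_iota.
Proof.
split=> [a b /env_cls_iota|x a|g a b].
- by rewrite pact1 => -[].
- split=> [|[c [<-]] [b _]].
    case xa: (theta x a) => [b|] // _.
    by exists (cls 1 b); [exact: env_iota_act | exists b].
  by rewrite /= env_actE mulg1 => /esym/env_cls_iota ->.
- move=> /env_opP[x [a' [c [aa' fa' /esym/env_cls_iota xc]]]].
  apply: (pA_actP fa' _ xc) => i; apply/env_cls_iota.
  by have /(congr1 (fun t => tnth t i)) := aa'; rewrite !tnth_map.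
Qed.

End EnvelopingAlgebra.

Theorem mainTheorem3 (G : groupType) (T : alg_type) (X : pA_obj G T)
    (hD : forall x : G, is_subalgebra (pact_dom (pA_act X) x)) :
  exists (Y : A_obj G T) (iota : pA_hom X Y), is_globalization iota.
Proof.
by exists (env_A hD), (env_iota hD); apply: env_iota_globalization.
Qed.
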